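(* Let $A\in\mathbb{R}^{m\times n}$ and $b\in\mathbb{R}^m$. The total least squares problem $$\min_{x\in\mathbb{R}^n}\ \frac{\|Ax-b\|^2}{\|x\|^2+1}$$ has no local non-global minimizer.
   Context: $\|\cdot\|$ denotes the Euclidean norm. A local non-global minimizer is a local minimizer that is not a global minimizer. *)

(* Defs.v *)
From mathcomp Require Import all_boot all_order all_algebra.
From mathcomp Require Import reals.
Set Implicit Arguments.
Unset Strict Implicit.
Unset Printing Implicit Defensive.
Import Order.TTheory GRing.Theory Num.Theory.
Local Open Scope ring_scope.

(* The norm that MathComp-Analysis puts on matrices is the sup norm, hence
   this definition. *)
Definition enorm (R : realType) (n : nat) (v : 'cV[R]_n) : R :=
  Num.sqrt (\sum_(i < n) v i ord0 ^+ 2).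

Definition global_minimizer (R : realType) (n : nat)
    (f : 'cV[R]_n -> R) (x : 'cV[R]_n) : Prop :=
  forall y : 'cV[R]_n, f x <= f y.

Definition local_minimizer (R : realType) (n : nat)
    (f : 'cV[R]_n -> R) (x : 'cV[R]_n) : Prop :=
  exists2 e : R, 0 < e &
    forall y : 'cV[R]_n, enorm (y - x) < e -> f x <= f y.

Definition local_nonglobal_minimizer (R : realType) (n : nat)
    (f : 'cV[R]_n -> R) (x : 'cV[R]_n) : Prop :=
  local_minimizer f x /\ ~ global_minimizer f x.

Definition tls_objective (R : realType) (m n : nat)
    (A : 'M[R]_(m, n)) (b : 'cV[R]_m) (x : 'cV[R]_n) : R :=
  enorm (A *m x - b) ^+ 2 / (enorm x ^+ 2 + 1).

(* Main.v *)
Require Import Defs.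
From mathcomp Require Import all_boot all_order all_algebra.
From mathcomp Require Import reals.
From mathcomp Require Import ring lra.
Import Order.TTheory GRing.Theory Num.Theory.
Local Open Scope ring_scope.

(** Let [l] be the value of the objective at a local minimizer [x].  Clearing
    the positive denominator, the value at [y] is at least [l] exactly when the
    quadratic function
      [g y = |A y - b|^2 - l (|y|^2 + 1)]
    is nonnegative ([tls_objective_le]); moreover [g x = 0].  So [g] is
    nonnegative near [x], and it remains to see that it is nonnegative
    everywhere.  Along the line from [x] in the direction [y - x] it is a
    quadratic polynomial [a t^2 + c t] ([enorm_sqr_line]) that is nonnegative
    for small [t] of both signs.  This forces [a >= 0], so the polynomial is
    convex, and a convex function vanishing at [0] and nonnegative at some
    [0 < t <= 1] is nonnegative at [1] ([quadratic_ge0_at1]), that is, at [y].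
    Hence [x] is a global minimizer. *)

Lemma enorm_ge0 (R : realType) (n : nat) (v : 'cV[R]_n) : 0 <= enorm v.
Proof. exact: sqrtr_ge0. Qed.

Lemma enorm_sqr (R : realType) (n : nat) (v : 'cV[R]_n) :
  enorm v ^+ 2 = \sum_(i < n) v i ord0 ^+ 2.
Proof. by rewrite sqr_sqrtr // sumr_ge0 // => i _; rewrite sqr_ge0. Qed.

Lemma enormZ (R : realType) (n : nat) (t : R) (v : 'cV[R]_n) :
  enorm (t *: v) = `|t| * enorm v.
Proof.
rewrite /enorm -sqrtr_sqr -sqrtrM ?sqr_ge0 // mulr_sumr.
by congr Num.sqrt; apply: eq_bigr => i _; rewrite mxE exprMn.
Qed.

Lemma enorm_sqr_line (R : realType) (n : nat) (u v : 'cV[R]_n) (t : R) :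
  enorm (u + t *: v) ^+ 2 =
  enorm u ^+ 2 + (\sum_(i < n) u i ord0 * v i ord0) *+ 2 * t
    + enorm v ^+ 2 * t ^+ 2.
Proof.
rewrite !enorm_sqr -sumrMnl !mulr_suml -!big_split /=.
by apply: eq_bigr => i _; rewrite !mxE; ring.
Qed.

(** Adding the values at [t] and [- t] gives [0 <= a]; then [a + c] dominates
    [a t + c], which is the value at [t] divided by [t]. *)
Lemma quadratic_ge0_at1 (R : realType) (a c t : R) :
  0 < t -> t <= 1 ->
  0 <= a * t ^+ 2 + c * t -> 0 <= a * (- t) ^+ 2 + c * (- t) ->
  0 <= a + c.
Proof.
move=> t0 t1 ht hNt.
have a0 : 0 <= a by rewrite -(pmulr_lge0 a (exprn_gt0 2 t0)); lra.
have : 0 <= a * t + c by rewrite -(pmulr_lge0 _ t0) mulrDl -mulrA -expr2.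
by have := ler_piMr a0 t1; lra.
Qed.

Lemma tls_objective_le (R : realType) (m n : nat)
    (A : 'M[R]_(m, n)) (b : 'cV[R]_m) (l : R) (y : 'cV[R]_n) :
  (l <= tls_objective A b y) =
  (0 <= enorm (A *m y - b) ^+ 2 - l * (enorm y ^+ 2 + 1)).
Proof. by rewrite /tls_objective ler_pdivlMr ?subr_ge0 // ltr_wpDl ?sqr_ge0. Qed.

Lemma tls_local_minimizer_global (R : realType) (m n : nat)
    (A : 'M[R]_(m, n)) (b : 'cV[R]_m) (x : 'cV[R]_n) :
  local_minimizer (tls_objective A b) x ->
  global_minimizer (tls_objective A b) x.
Proof.
move=> [e e0 xmin] y; set l := tls_objective A b x in xmin *.
pose d := y - x.
pose g z := enorm (A *m z - b) ^+ 2 - l * (enorm z ^+ 2 + 1).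
have gx : g x = 0.
  rewrite /g /l /tls_objective divfK ?subrr //.
  by rewrite gt_eqF // ltr_wpDl ?sqr_ge0.
have [a [c gline]] : exists a c, forall t, g (x + t *: d) = a * t ^+ 2 + c * t.
  pose dot k (u v : 'cV[R]_k) := \sum_(i < k) u i ord0 * v i ord0.
  exists (enorm (A *m d) ^+ 2 - l * enorm d ^+ 2).
  exists (dot m (A *m x - b) (A *m d) *+ 2 - l * (dot n x d *+ 2)) => t.
  rewrite -[RHS]add0r -gx /g mulmxDr -scalemxAr addrAC !enorm_sqr_line /dot.
  by ring.
have ed0 : 0 < e + enorm d by rewrite ltr_wpDr ?enorm_ge0.
(* A step in ]0, 1] that keeps x + t d and x - t d within distance e of x,
   also when d = 0. *)
pose t := e / (e + enorm d).
have t0 : 0 < t by rewrite divr_gt0.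
have t1 : t <= 1 by rewrite ler_pdivrMr // mul1r lerDl enorm_ge0.
have near s : `|s| = t -> 0 <= a * s ^+ 2 + c * s.
  move=> st; rewrite -gline -tls_objective_le; apply: xmin.
  rewrite addrC addKr enormZ st mulrAC ltr_pdivrMr // ltr_pM2l //.
  by rewrite ltrDr.
rewrite tls_objective_le -/(g y).
have -> : y = x + 1 *: d by rewrite scale1r addrC subrK.
rewrite gline expr1n !mulr1; apply: (quadratic_ge0_at1 _ _ _ _ t0 t1).
  by apply: near; rewrite gtr0_norm.
by apply: near; rewrite normrN gtr0_norm.
Qed.

Theorem corollary3p6 (R : realType) (m n : nat)
    (A : 'M[R]_(m, n)) (b : 'cV[R]_m) :
  ~ exists x : 'cV[R]_n, local_nonglobal_minimizer (tls_objective A b) x.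
Proof. by move=> [x [/tls_local_minimizer_global]]. Qed.
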